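(* Let $0\le\beta\le 1$ and let $f\in\mathcal{A}_{\beta}$ with $f(z)=z+\sum_{n=2}^\infty a_nz^n$. Let $\gamma_1=\tfrac12 a_2$, $\gamma_2=\tfrac12\left(a_3-\tfrac12 a_2^2\right)$, $\gamma_3=\tfrac12\left(a_4-a_2a_3+\tfrac13 a_2^3\right)$. Then \[ |\gamma_m|\le \frac{1}{(m+1)-m\beta},\qquad m=1,2,3. \] Moreover, all three bounds are sharp: for each $m\in\{1,2,3\}$ there exists $f\in\mathcal{A}_\beta$ for which equality holds.
   Context: $\mathbb{D}=\{z\in\mathbb{C}:|z|<1\}$. $\mathcal{A}$ denotes the class of holomorphic functions $f$ on $\mathbb{D}$ with $f(0)=0$, $f'(0)=1$, written $f(z)=z+\sum_{n\ge2}a_nz^n$. For $\beta\in[0,1]$, $\mathcal{A}_{\beta}=\{f\in\mathcal{A}: \operatorname{Re}\big(\beta\, f(z)/z+(1-\beta)f'(z)\big)>0 \text{ for all } z\in\mathbb{D}\}$ (with $f(z)/z$ extended by $1$ at $z=0$). The numbers $\gamma_n$ are the logarithmic coefficients, defined by $\log(f(z)/z)=2\sum_{n\ge1}\gamma_n z^n$ near $0$; the formulas for $\gamma_1,\gamma_2,\gamma_3$ above are the resulting expressions. *)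

(* Defs.v *)
From Stdlib Require Import Reals.
From Coquelicot Require Import Coquelicot.
Open Scope R_scope.

Definition in_disk (z : C) : Prop := Cmod z < 1.

Definition quot_z (f : C -> C) (z : C) : C :=
  match Ceq_dec z 0%C with
  | left _ => 1%C
  | right _ => (f z / z)%C
  end.

Definition holo_disk (f : C -> C) : Prop :=
  forall z, in_disk z -> @ex_derive C_AbsRing C_NormedModule f z.

Definition class_A (f : C -> C) : Prop :=
  holo_disk f /\ f (RtoC 0) = RtoC 0 /\ @is_derive C_AbsRing C_NormedModule f (RtoC 0) (RtoC 1).

Definition class_A_beta (beta : R) (f : C -> C) : Prop :=
  class_A f /\
  forall z (f' : C), in_disk z -> @is_derive C_AbsRing C_NormedModule f z f' ->
    0 < Re (RtoC beta * quot_z f z + RtoC (1 - beta) * f')%C.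

Definition taylor_coeffs (f : C -> C) (a : nat -> C) : Prop :=
  forall z, in_disk z -> @is_pseries C_AbsRing C_NormedModule a z (f z).

(* logarithmic coefficients gamma_1, gamma_2, gamma_3 via the given formulas *)
Definition gamma (a : nat -> C) (m : nat) : C :=
  match m with
  | 1%nat => (/ 2 * a 2%nat)%C
  | 2%nat => (/ 2 * (a 3%nat - / 2 * a 2%nat ^ 2))%C
  | 3%nat => (/ 2 * (a 4%nat - a 2%nat * a 3%nat + / 3 * a 2%nat ^ 3))%C
  | _ => 0%C
  end.

(* Main.v *)
Require Import Defs.
From Stdlib Require Import Reals Lra Lia Psatz.
From Coquelicot Require Import Coquelicot.
Open Scope R_scope.

(* The function [p = beta f/z + (1 - beta) f'] has positive real part, [p 0 = 1] and
   coefficients [p_n = (n + 1 - n beta) a_(n+1)].  Averaging [Re p |q|^2] over circles,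
   with [q] a cubic polynomial, shows that the Hermitian Toeplitz form of
   [2, p_1, p_2, p_3] is nonnegative.  Writing [p = (1 + w)/(1 - w)] with
   [w = c1 z + c2 z^2 + c3 z^3 + ...], suitable cubic test vectors give [|c1| <= 1],
   [|c2| <= 1 - |c1|^2] and [|c3| <= 1 - |c1|^2 - |c2|^2 / 2].  With [d = m + 1 - m beta],
   [d gamma_m] is [c1], [c2 + t c1^2] and [c3 + t c1 c2 + v c1^3] for [m = 1, 2, 3], where
   [0 <= t <= 1] and [0 <= v <= 1/2], and these have modulus at most 1.  Equality holds
   for [p = (1 + z^m)/(1 - z^m)]. *)

(** * Partial sums, limits and radius of convergence of complex power series *)

(** The bound is exclusive, so the empty sum is available and [psum] at [S n] matches [sum_n] at
    [n]. *)
Fixpoint psum (a : nat -> C) (z : C) (n : nat) : C :=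
  match n with
  | O => 0%C
  | S k => (psum a z k + a k * z ^ k)%C
  end.

Lemma psum_S (a : nat -> C) (z : C) (n : nat) :
  psum a z (S n) = (psum a z n + a n * z ^ n)%C.
Proof. reflexivity. Qed.

Definition Cconv (s : nat -> C) (l : C) : Prop :=
  forall eps, 0 < eps -> exists N : nat, forall n, (N <= n)%nat -> Cmod (s n - l)%C < eps.

Lemma pow_n_Cpow (z : C) (n : nat) : pow_n (K := C_Ring) z n = (z ^ n)%C.
Proof. induction n as [|n IH]; [reflexivity|]; cbn [pow_n Cpow]; now rewrite IH. Qed.

Lemma psum_sum_n (a : nat -> C) (z : C) (n : nat) :
  sum_n (fun k => scal (pow_n z k) (a k) : C_NormedModule) n = psum a z (S n).
Proof.
  induction n as [|n IH].
  - rewrite sum_O. change (pow_n z 0 * a 0%nat = 0 + a 0%nat * z ^ 0)%C.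
    rewrite (pow_n_Cpow z); ring.
  - rewrite sum_Sn, IH.
    change (psum a z (S n) + pow_n z (S n) * a (S n) = psum a z (S n) + a (S n) * z ^ (S n))%C.
    rewrite (pow_n_Cpow z); ring.
Qed.

(** This trades the filters behind [is_pseries] for an epsilon criterion on partial sums, on which
    all later limit arguments run. *)
Lemma is_pseries_Cconv (a : nat -> C) (z l : C) :
  @is_pseries C_AbsRing C_NormedModule a z l <-> Cconv (psum a z) l.
Proof.
  unfold is_pseries, is_series; split.
  - intros H eps He.
    assert (HP : @locally C_UniformSpace l (fun y => Cmod (y - l)%C < eps)).
    { apply (@locally_le_locally_norm C_AbsRing C_NormedModule).
      exists (mkposreal eps He); intros y Hy; exact Hy. }
    destruct (H _ HP) as [N HN].
    exists (S N); intros [|n] Hn; [lia|].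
    rewrite <- psum_sum_n; apply HN; lia.
  - intros H P HP.
    apply (@locally_norm_le_locally C_AbsRing C_NormedModule) in HP.
    destruct HP as [eps HP].
    destruct (H eps (cond_pos eps)) as [N HN].
    exists N; intros n Hn; apply HP.
    rewrite psum_sum_n; apply HN; lia.
Qed.

Lemma Cmod_sub_triangle (z w : C) : Cmod w <= Cmod z + Cmod (w - z)%C.
Proof.
  replace w with (z + (w - z))%C at 1 by ring; apply Cmod_triangle.
Qed.

Lemma Cconv_le (s : nat -> C) (l : C) (K : R) (N0 : nat) :
  Cconv s l -> (forall n, (N0 <= n)%nat -> Cmod (s n) <= K) -> Cmod l <= K.
Proof.
  intros H HK; apply Rnot_lt_le; intros Hlt.
  destruct (H (Cmod l - K)) as [N HN]; [lra|].
  specialize (HN (N + N0)%nat ltac:(lia)); specialize (HK (N + N0)%nat ltac:(lia)).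
  assert (T := Cmod_triangle (- (s (N + N0)%nat - l)) (s (N + N0)%nat)).
  rewrite Cmod_opp in T.
  replace (- (s (N + N0)%nat - l) + s (N + N0)%nat)%C with l in T by ring.
  lra.
Qed.

Lemma Cconv_lin (s t : nat -> C) (l m c d : C) :
  Cconv s l -> Cconv t m -> Cconv (fun n => c * s n + d * t n)%C (c * l + d * m)%C.
Proof.
  intros Hs Ht eps He.
  assert (Hc := Cmod_ge_0 c). assert (Hd := Cmod_ge_0 d).
  assert (Hp : 0 < eps / (Cmod c + Cmod d + 1)) by (apply Rdiv_lt_0_compat; lra).
  destruct (Hs _ Hp) as [N1 H1]; destruct (Ht _ Hp) as [N2 H2].
  exists (N1 + N2)%nat; intros n Hn.
  specialize (H1 n ltac:(lia)); specialize (H2 n ltac:(lia)).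
  replace (c * s n + d * t n - (c * l + d * m))%C
    with (c * (s n - l) + d * (t n - m))%C by ring.
  eapply Rle_lt_trans; [apply Cmod_triangle|].
  rewrite !Cmod_mult.
  set (e := eps / (Cmod c + Cmod d + 1)) in *.
  assert (eps = (Cmod c + Cmod d + 1) * e) by (unfold e; field; lra).
  nra.
Qed.

Lemma Cconv_unique (s : nat -> C) (l m : C) : Cconv s l -> Cconv s m -> l = m.
Proof.
  intros Hl Hm; apply Ceq_minus, Cmod_eq_0, Rle_antisym; [|apply Cmod_ge_0].
  apply Cconv_le with (s := fun n => (1 * s n + - (1) * s n)%C) (N0 := 0%nat).
  - replace (l - m)%C with (1 * l + - (1) * m)%C by ring.
    now apply Cconv_lin.
  - intros n _; cbv beta.
    assert (E : (1 * s n + - (1) * s n = 0)%C) by ring.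
    rewrite E, Cmod_0; lra.
Qed.

Lemma Cconv_shift (s t : nat -> C) (l : C) (p : nat) :
  (forall n, t n = s (n + p)%nat) -> Cconv s l -> Cconv t l.
Proof.
  intros E H eps He; destruct (H eps He) as [N HN]; exists N; intros n Hn.
  rewrite E; apply HN; lia.
Qed.

(* [CV_radius] exists only for real power series; passing to the moduli of the
   coefficients gives access to [CV_radius_derive]. *)
Lemma disk_pseries_CV_radius (a : nat -> C) :
  (forall z, in_disk z -> exists l, @is_pseries C_AbsRing C_NormedModule a z l) ->
  Rbar_le 1 (CV_radius (fun n => Cmod (a n))).
Proof.
  intros H.
  assert (Hr : forall r, 0 <= r < 1 -> Rbar_le r (CV_radius (fun n => Cmod (a n)))).
  { intros r Hr.
    apply (proj1 (CV_radius_bounded (fun n => Cmod (a n)))).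
    destruct (H (RtoC r)) as [l Hl].
    { unfold in_disk; rewrite Cmod_R, Rabs_pos_eq; lra. }
    destruct (@filterlim_bounded C_AbsRing C_NormedModule
      (sum_n (fun k => scal (pow_n (RtoC r : C_AbsRing) k) (a k) : C_NormedModule)))
      as [M HM].
    { exists l; exact Hl. }
    assert (HM' : forall n, Cmod (psum a (RtoC r) n) <= M).
    { intros [|n].
      - simpl; rewrite Cmod_0. eapply Rle_trans; [apply (@norm_ge_0 C_AbsRing C_NormedModule)|apply (HM 0%nat)].
      - rewrite <- psum_sum_n; apply HM. }
    (* Each term is a difference of two consecutive partial sums, both of modulus at most [M]. *)
    exists (M + M); intros n.
    assert (E : (a n * RtoC r ^ n = psum a (RtoC r) (S n) + - psum a (RtoC r) n)%C)
      by (simpl; ring).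
    rewrite Rabs_mult, (Rabs_pos_eq (Cmod _)) by apply Cmod_ge_0.
    rewrite <- Cmod_R, RtoC_pow, <- Cmod_mult, E.
    eapply Rle_trans; [apply Cmod_triangle|].
    rewrite Cmod_opp; apply Rplus_le_compat; apply HM'. }
  destruct (CV_radius (fun n => Cmod (a n))) as [R0| |] eqn:E; simpl; auto.
  - apply Rnot_lt_le; intros Hlt.
    assert (H0 := Hr 0 ltac:(lra)); simpl in H0.
    assert (H1 := Hr ((R0 + 1) / 2) ltac:(lra)); simpl in H1; lra.
  - apply (Hr 0); lra.
Qed.

(** * Termwise differentiation *)

Definition Cderiv_coef (a : nat -> C) (n : nat) : C := (RtoC (INR (S n)) * a (S n))%C.

Lemma sum_n_le_Series (u : nat -> R) (n : nat) :
  (forall k, 0 <= u k) -> ex_series u -> sum_n u n <= Series u.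
Proof.
  intros Hu Hs; apply (is_lim_seq_incr_compare (sum_n u)).
  - apply Series_correct; exact Hs.
  - intros k; rewrite sum_Sn; change (sum_n u k <= sum_n u k + u (S k)).
    specialize (Hu (S k)); lra.
Qed.

(* The bound is the general term of the twice differentiated modulus series, which
   makes the remainder estimate summable. *)
Lemma Cpow_second_order (z w : C) (r : R) (n : nat) :
  Cmod z <= r -> Cmod w <= r ->
  Cmod (w ^ (S (S n)) - z ^ (S (S n)) - RtoC (INR (S (S n))) * z ^ (S n) * (w - z))%C
  <= INR (S n) * INR (S (S n)) * r ^ n * Cmod (w - z)%C ^ 2.
Proof.
  intros Hz Hw.
  assert (Hz0 := Cmod_ge_0 z).
  induction n as [|n IH].
  - replace (w ^ 2 - z ^ 2 - RtoC (INR 2) * z ^ 1 * (w - z))%C with ((w - z) ^ 2)%C.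
    + rewrite Cmod_pow; simpl INR.
      assert (0 <= Cmod (w - z)%C ^ 2) by (apply pow_le, Cmod_ge_0). nra.
    + change (INR 2) with (1 + 1); rewrite RtoC_plus; simpl; ring.
  - set (k := S (S n)) in *.
    replace (w ^ S k - z ^ S k - RtoC (INR (S k)) * z ^ k * (w - z))%C
      with (w * (w ^ k - z ^ k - RtoC (INR k) * z ^ (S n) * (w - z))
            + RtoC (INR k) * z ^ (S n) * (w - z) ^ 2)%C.
    2:{ rewrite (S_INR k), RtoC_plus. unfold k; simpl; ring. }
    eapply Rle_trans; [apply Cmod_triangle|].
    rewrite !Cmod_mult, Cmod_R, !Cmod_pow, Rabs_pos_eq by apply pos_INR.
    assert (H2 : 0 <= Cmod (w - z)%C ^ 2) by (apply pow_le, Cmod_ge_0).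
    set (h := Cmod (w - z)%C ^ 2) in *.
    assert (Hzn : Cmod z ^ S n <= r ^ S n) by (apply pow_incr; lra).
    assert (Hk := pos_INR k).
    assert (Hr : 0 <= r ^ n) by (apply pow_le; lra).
    set (X := Cmod (w ^ k - z ^ k - RtoC (INR k) * z ^ S n * (w - z))%C) in *.
    assert (HX : 0 <= X) by apply Cmod_ge_0.
    assert (Cmod w * X <= r * (INR (S n) * INR k * r ^ n * h)).
    { apply Rmult_le_compat; auto using Cmod_ge_0. }
    assert (INR k * Cmod z ^ S n * h <= INR k * r ^ S n * h).
    { apply Rmult_le_compat_r; auto; apply Rmult_le_compat_l; auto. }
    eapply Rle_trans; [apply Rplus_le_compat; eassumption|].
    rewrite (S_INR k).
    replace (INR (S n)) with (INR k - 1) by (unfold k; rewrite (S_INR (S n)); ring).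
    simpl pow.
    assert (0 <= r * r ^ n) by (apply Rmult_le_pos; lra).
    assert (0 <= r * r ^ n * h) by (apply Rmult_le_pos; lra).
    nra.
Qed.

(** Summing [Cpow_second_order] against the coefficients bounds the remainder
    [f w - f z - (w - z) g] by a constant times [|w - z|^2] on a closed disk of radius [r] with
    [|z| < r < 1]. A quadratic remainder identifies [g] as the derivative. *)
Lemma taylor_coeffs_derive (f : C -> C) (a : nat -> C) (z : C) :
  taylor_coeffs f a -> in_disk z ->
  exists g, @is_derive C_AbsRing C_NormedModule f z g
    /\ @is_pseries C_AbsRing C_NormedModule (Cderiv_coef a) z g.
Proof.
  intros Hf Hz; unfold in_disk in Hz.
  assert (Hz0 := Cmod_ge_0 z).
  set (r := (1 + Cmod z) / 2).
  assert (Hr : Cmod z < r < 1) by (unfold r; lra).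
  set (b := fun n => Cmod (a n)).
  assert (HCV : Rbar_le 1 (CV_radius b)).
  { apply disk_pseries_CV_radius; intros y Hy; exists (f y); apply Hf; exact Hy. }
  assert (Hlt : Rbar_lt (Rabs r) (CV_radius b)).
  { rewrite Rabs_pos_eq by lra.
    eapply Rbar_lt_le_trans; [|exact HCV]; simpl; lra. }
  (* Differentiation keeps the radius of convergence, so the once and twice differentiated modulus
     series converge at [r]. The first yields the sum [g], the second the constant [K] of the
     remainder. *)
  assert (E1 : ex_series (fun n => INR (S n) * Cmod (a (S n)) * r ^ n)).
  { apply (ex_series_ext (fun n => Rabs (PS_derive b n * r ^ n))); [|apply CV_disk_inside].
    - intros n; apply Rabs_pos_eq.
      unfold PS_derive, b; repeat apply Rmult_le_pos; auto using pos_INR, Cmod_ge_0.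
      apply pow_le; lra.
    - rewrite CV_radius_derive; exact Hlt. }
  assert (E2 : ex_series (fun n => INR (S n) * INR (S (S n)) * Cmod (a (S (S n))) * r ^ n)).
  { apply (ex_series_ext (fun n => Rabs (PS_derive (PS_derive b) n * r ^ n)));
      [|apply CV_disk_inside].
    - intros n; transitivity (PS_derive (PS_derive b) n * r ^ n).
      + apply Rabs_pos_eq; unfold PS_derive, b.
        repeat apply Rmult_le_pos; auto using pos_INR, Cmod_ge_0; apply pow_le; lra.
      + unfold PS_derive, b.
        match goal with |- @eq _ ?x ?y => change (@eq R x y) end; ring.
    - rewrite !CV_radius_derive; exact Hlt. }
  assert (Eg : @ex_series C_AbsRing C_NormedModule
    (fun k => scal (pow_n (z : C_AbsRing) k) (Cderiv_coef a k))).
  { apply (@ex_series_le C_AbsRing C_CompleteNormedModule _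
      (fun n => INR (S n) * Cmod (a (S n)) * r ^ n)); [|exact E1].
    intros n.
    change (Cmod (pow_n (K := C_Ring) z n * Cderiv_coef a n)%C
            <= INR (S n) * Cmod (a (S n)) * r ^ n).
    rewrite pow_n_Cpow; unfold Cderiv_coef.
    rewrite !Cmod_mult, Cmod_pow, Cmod_R, Rabs_pos_eq by apply pos_INR.
    rewrite Rmult_comm; apply Rmult_le_compat_l.
    - apply Rmult_le_pos; auto using pos_INR, Cmod_ge_0.
    - apply pow_incr; lra. }
  destruct Eg as [g Hg].
  exists g; split; [|exact Hg].
  change (@is_pseries C_AbsRing C_NormedModule (Cderiv_coef a) z g) in Hg.
  apply is_pseries_Cconv in Hg.
  set (u := fun n => INR (S n) * INR (S (S n)) * Cmod (a (S (S n))) * r ^ n) in E2.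
  assert (Hu : forall n, 0 <= u n).
  { intros n; unfold u; repeat apply Rmult_le_pos; auto using pos_INR, Cmod_ge_0.
    apply pow_le; lra. }
  set (K := Series u).
  assert (HK : forall n, sum_n u n <= K) by (intros n; now apply sum_n_le_Series).
  assert (HK0 : 0 <= K)
    by (eapply Rle_trans; [apply (Hu 0%nat)|rewrite <- (sum_O u); apply HK]).
  assert (Hq : forall w, Cmod w <= r ->
    Cmod (f w - f z - (w - z) * g)%C <= K * Cmod (w - z)%C ^ 2).
  { intros w Hw.
    (* The powers 0 and 1 contribute nothing to the remainder, so the sum of [u] up to [n] controls
       the powers up to [n + 2]. This accounts for [n + 3] terms of [a] and [n + 2] terms of its
       derivative. *)
    apply Cconv_le with (N0 := 0%nat)
      (s := fun n => (1 * (1 * psum a w (n + 3) + - (1) * psum a z (n + 3))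
          + - (w - z) * psum (Cderiv_coef a) z (n + 2))%C).
    - replace (f w - f z - (w - z) * g)%C
        with (1 * (1 * f w + - (1) * f z) + - (w - z) * g)%C by ring.
      apply Cconv_lin; [apply Cconv_lin|].
      + eapply Cconv_shift; [reflexivity|].
        apply is_pseries_Cconv, Hf; unfold in_disk; lra.
      + eapply Cconv_shift; [reflexivity|].
        apply is_pseries_Cconv, Hf; unfold in_disk; lra.
      + eapply Cconv_shift; [reflexivity|]. exact Hg.
    - intros n _.
      eapply Rle_trans; [|apply Rmult_le_compat_r; [apply pow_le, Cmod_ge_0|apply (HK n)]].
      assert (Hterm : forall n,
        Cmod (a (S (S n)) * (w ^ (S (S n)) - z ^ (S (S n))
            - RtoC (INR (S (S n))) * z ^ (S n) * (w - z)))%C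
        <= INR (S n) * INR (S (S n)) * Cmod (a (S (S n))) * r ^ n * Cmod (w - z)%C ^ 2).
      { intros k; rewrite Cmod_mult.
        eapply Rle_trans; [apply Rmult_le_compat_l; [apply Cmod_ge_0|]|].
        - apply (Cpow_second_order z w r k); lra.
        - right; ring. }
      induction n as [|n IH].
      + rewrite sum_O. eapply Rle_trans; [|apply (Hterm 0%nat)].
        right; f_equal; simpl psum; unfold Cderiv_coef.
        change (INR 1) with 1; simpl; ring.
      + rewrite sum_Sn. unfold plus; simpl AbelianMonoid.plus.
        rewrite Rmult_plus_distr_r.
        eapply Rle_trans; [|apply Rplus_le_compat; [exact IH|apply (Hterm (S n))]].
        eapply Rle_trans; [|apply Cmod_triangle].
        right; f_equal.
        replace (S n + 3)%nat with (S (n + 3)) by lia.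
        replace (S n + 2)%nat with (S (n + 2)) by lia.
        simpl psum; unfold Cderiv_coef.
        replace (n + 3)%nat with (S (S (S n))) by lia.
        replace (n + 2)%nat with (S (S n)) by lia.
        ring. }
  split; [apply is_linear_scal_l|].
  intros x Hx eps.
  apply (@is_filter_lim_locally_unique C_AbsRing (AbsRing_NormedModule C_AbsRing)) in Hx; subst x.
  (* The first bound keeps [w] in the disk of radius [r]; the second makes [K |w - z| <= eps], with
     [K + 1] guarding against [K = 0]. *)
  assert (Hd : 0 < Rmin (r - Cmod z) (eps / (K + 1))).
  { apply Rmin_pos; [lra|apply Rdiv_lt_0_compat; [apply cond_pos|lra]]. }
  exists (mkposreal _ Hd); intros w Hw.
  change (Cmod (w - z)%C < Rmin (r - Cmod z) (eps / (K + 1))) in Hw.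
  change (Cmod (f w - f z - (w - z) * g)%C <= eps * Cmod (w - z)%C).
  assert (Hw1 := Rmin_l (r - Cmod z) (eps / (K + 1))).
  assert (Hw2 := Rmin_r (r - Cmod z) (eps / (K + 1))).
  assert (Hwr : Cmod w <= r).
  { assert (T := Cmod_sub_triangle z w); lra. }
  eapply Rle_trans; [apply Hq, Hwr|].
  assert (Hh := Cmod_ge_0 (w - z)%C). set (h := Cmod (w - z)%C) in *.
  assert (Ee : (pos eps) = (K + 1) * (eps / (K + 1))) by (field; lra).
  assert (K * h <= eps) by nra.
  nra.
Qed.

(** * Discrete averages over roots of unity *)

Fixpoint Csum (F : nat -> C) (n : nat) : C :=
  match n with
  | O => 0%C
  | S k => (Csum F k + F k)%C
  end.

Lemma Csum_ext (F G : nat -> C) (n : nat) :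
  (forall k, F k = G k) -> Csum F n = Csum G n.
Proof. intros E; induction n as [|n IH]; simpl; [|rewrite IH, E]; reflexivity. Qed.

Lemma Csum_zero (n : nat) : Csum (fun _ => 0%C) n = 0%C.
Proof. induction n as [|n IH]; cbn [Csum]; [|rewrite IH]; ring. Qed.

Lemma Csum_lin (F G : nat -> C) (c : C) (n : nat) :
  Csum (fun k => F k + c * G k)%C n = (Csum F n + c * Csum G n)%C.
Proof. induction n as [|n IH]; simpl; [|rewrite IH]; ring. Qed.

Lemma Csum_one (n : nat) : Csum (fun _ => 1%C) n = RtoC (INR n).
Proof.
  induction n as [|n IH]; [reflexivity|].
  cbn [Csum]; rewrite IH, S_INR, RtoC_plus; reflexivity.
Qed.

Lemma Csum_conj (F : nat -> C) (n : nat) :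
  Cconj (Csum F n) = Csum (fun k => Cconj (F k)) n.
Proof.
  induction n as [|n IH]; cbn [Csum].
  - unfold Cconj; simpl; now rewrite Ropp_0.
  - now rewrite Cplus_conj, IH.
Qed.

Lemma Csum_geom (u : C) (n : nat) :
  ((1 - u) * Csum (fun k => u ^ k) n = 1 - u ^ n)%C.
Proof.
  induction n as [|n IH]; cbn [Csum Cpow]; [ring|].
  rewrite Cmult_plus_distr_l, IH; ring.
Qed.

Definition root_unity (N : nat) : C := (cos (2 * PI / INR N), sin (2 * PI / INR N)).

Lemma root_unity_pow (N k : nat) :
  (root_unity N ^ k)%C = (cos (INR k * (2 * PI / INR N)), sin (INR k * (2 * PI / INR N))).
Proof.
  induction k as [|k IH].
  - simpl INR; rewrite Rmult_0_l, cos_0, sin_0; reflexivity.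
  - cbn [Cpow]; rewrite IH; unfold root_unity, Cmult; cbn [fst snd].
    set (t := 2 * PI / INR N).
    rewrite S_INR, Rmult_plus_distr_r, Rmult_1_l, cos_plus, sin_plus.
    f_equal; ring.
Qed.

Lemma root_unity_unit (N k : nat) : (root_unity N ^ k * Cconj (root_unity N ^ k) = 1)%C.
Proof.
  rewrite <- Cmod2_conj, Cmod2_alt, root_unity_pow; simpl Re; simpl Im.
  set (t := INR k * _); generalize (sin2_cos2 t); unfold Rsqr; intros E.
  replace (cos t ^ 2 + sin t ^ 2) with 1 by (simpl; lra). reflexivity.
Qed.

Lemma root_unity_pow_N (N : nat) : (0 < N)%nat -> (root_unity N ^ N)%C = 1%C.
Proof.
  intros H; apply lt_INR in H; simpl in H.
  rewrite root_unity_pow.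
  replace (INR N * (2 * PI / INR N)) with (2 * PI) by (field; lra).
  rewrite cos_2PI, sin_2PI; reflexivity.
Qed.

Lemma root_unity_pow_neq1 (N d : nat) : (0 < d < N)%nat -> (root_unity N ^ d)%C <> 1%C.
Proof.
  intros [H1 H2] E; apply lt_INR in H1; apply lt_INR in H2; simpl in H1.
  rewrite root_unity_pow in E; apply (f_equal fst) in E; simpl in E.
  assert (HP := PI_RGT_0).
  set (q := INR d / INR N).
  assert (Hq : 0 < q < 1).
  { unfold q; split; [apply Rdiv_lt_0_compat; lra|].
    apply Rmult_lt_reg_r with (INR N); [lra|].
    unfold Rdiv; rewrite Rmult_assoc, Rinv_l; lra. }
  replace (INR d * (2 * PI / INR N)) with (2 * (q * PI)) in E by (unfold q; field; lra).
  (* With [cos (2x) = 1 - 2 sin^2 x], a cosine equal to 1 forces [sin (q PI) = 0], impossible for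
     [0 < q < 1]. *)
  rewrite cos_2a_sin in E.
  assert (0 < sin (q * PI)) by (apply sin_gt_0; nra).
  nra.
Qed.

(** A geometric sum of ratio [root_unity N ^ d], which differs from 1 while its [N]-th power equals
    1. *)
Lemma root_unity_sum (N d : nat) :
  (0 < d < N)%nat -> Csum (fun k => (root_unity N ^ k) ^ d)%C N = 0%C.
Proof.
  intros H.
  assert (E := Csum_geom (root_unity N ^ d) N).
  rewrite <- Cpow_mult_r, Nat.mul_comm, Cpow_mult_r, root_unity_pow_N, Cpow_1_l in E by lia.
  rewrite (Csum_ext _ (fun k => (root_unity N ^ d) ^ k)%C)
    by (intros k; rewrite <- !Cpow_mult_r; f_equal; lia).
  assert (Hd : (1 - root_unity N ^ d)%C <> 0%C).
  { apply Cminus_eq_contra; intros E'; apply (root_unity_pow_neq1 N d H); now rewrite E'. }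
  set (s := Csum _ _) in *.
  replace s with (/ (1 - root_unity N ^ d) * ((1 - root_unity N ^ d) * s))%C by (now field).
  rewrite E; ring.
Qed.

Lemma root_unity_orth (N a b : nat) : (a < N)%nat -> (b < N)%nat ->
  Csum (fun k => (root_unity N ^ k) ^ a * Cconj (root_unity N ^ k) ^ b)%C N
  = if Nat.eq_dec a b then RtoC (INR N) else 0%C.
Proof.
  intros Ha Hb.
  assert (U : forall k m, ((root_unity N ^ k) ^ m * Cconj (root_unity N ^ k) ^ m = 1)%C).
  { intros k m; rewrite <- Cpow_mult_l, root_unity_unit; apply Cpow_1_l. }
  destruct (Nat.eq_dec a b) as [->|Hne].
  - rewrite <- Csum_one; apply Csum_ext; intros k; apply U.
  - destruct (Nat.lt_ge_cases b a) as [Hlt|Hge].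
    + rewrite <- (root_unity_sum N (a - b)) by lia.
      apply Csum_ext; intros k.
      replace a with (b + (a - b))%nat at 1 by lia.
      rewrite Cpow_add_r.
      transitivity (((root_unity N ^ k) ^ b * Cconj (root_unity N ^ k) ^ b) * (root_unity N ^ k) ^ (a - b))%C;
        [ring|rewrite U; ring].
    (* For [a < b] the surplus factor is a power of the conjugate, so the sum is the conjugate of a
       vanishing one. *)
    + transitivity (Cconj (Csum (fun k => (root_unity N ^ k) ^ (b - a))%C N)).
      * rewrite Csum_conj; apply Csum_ext; intros k.
        replace b with (a + (b - a))%nat at 1 by lia.
        rewrite Cpow_add_r, (Cpow_conj (root_unity N ^ k)).
        transitivity (((root_unity N ^ k) ^ a * Cconj (root_unity N ^ k) ^ a) * Cconj (root_unity N ^ k) ^ (b - a))%C;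
          [ring|rewrite U; ring].
      * rewrite root_unity_sum by lia. unfold Cconj; simpl; now rewrite Ropp_0.
Qed.

(** Orthogonality extracts the coefficient of index [j - i]. The condition [M + i <= N] prevents
    aliasing: every exponent [i + k] with [k < M] stays below [N], so none can agree with [j] only
    modulo [N]. *)
Lemma root_unity_coef (c : nat -> C) (N M i j : nat) : (M + i <= N)%nat -> (j < N)%nat ->
  Csum (fun k => (root_unity N ^ k) ^ i * Cconj (root_unity N ^ k) ^ j * psum c (root_unity N ^ k) M)%C N
  = if Nat.leb i j then if Nat.ltb (j - i) M then (RtoC (INR N) * c (j - i)%nat)%C else 0%C
    else 0%C.
Proof.
  intros HM Hj.
  induction M as [|M IH].
  - transitivity (Csum (fun _ => 0%C) N).
    + apply Csum_ext; intros k; cbn [psum]; ring.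
    + rewrite Csum_zero; now destruct (Nat.leb i j).
  - rewrite (Csum_ext _ (fun k => ((root_unity N ^ k) ^ i * Cconj (root_unity N ^ k) ^ j * psum c (root_unity N ^ k) M)
        + c M * ((root_unity N ^ k) ^ (i + M) * Cconj (root_unity N ^ k) ^ j))%C).
    2:{ intros k; rewrite Cpow_add_r; cbn [psum]; ring. }
    rewrite Csum_lin, IH, root_unity_orth by lia.
    destruct (Nat.leb_spec i j) as [Hij|Hij].
    + destruct (Nat.ltb_spec (j - i) M); destruct (Nat.ltb_spec (j - i) (S M));
        destruct (Nat.eq_dec (i + M) j); try lia; try ring.
      replace (j - i)%nat with M by lia; ring.
    + destruct (Nat.eq_dec (i + M) j); [lia|ring].
Qed.

(** * Nonnegativity of the Toeplitz form *)

Lemma Csum_quad_expand (S : nat -> C) (xi : nat -> C) (x0 x1 x2 x3 : C) (n : nat) :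
  let T := fun i j => Csum (fun k => xi k ^ i * Cconj (xi k) ^ j * S k)%C n in
  Csum (fun k => S k * ((x0 + x1 * xi k + x2 * xi k ^ 2 + x3 * xi k ^ 3)
     * Cconj (x0 + x1 * xi k + x2 * xi k ^ 2 + x3 * xi k ^ 3)))%C n
  = (x0 * (Cconj x0 * T 0 0 + Cconj x1 * T 0 1 + Cconj x2 * T 0 2 + Cconj x3 * T 0 3)
   + x1 * (Cconj x0 * T 1 0 + Cconj x1 * T 1 1 + Cconj x2 * T 1 2 + Cconj x3 * T 1 3)
   + x2 * (Cconj x0 * T 2 0 + Cconj x1 * T 2 1 + Cconj x2 * T 2 2 + Cconj x3 * T 2 3)
   + x3 * (Cconj x0 * T 3 0 + Cconj x1 * T 3 1 + Cconj x2 * T 3 2 + Cconj x3 * T 3 3))%C%nat.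
Proof.
  cbv zeta; induction n as [|n IH].
  - cbn [Csum]; ring.
  - cbn [Csum]; rewrite IH.
    rewrite !Cplus_conj, !Cmult_conj, !Cpow_conj.
    ring.
Qed.

Lemma Re_Csum_ge (F : nat -> C) (e : R) (n : nat) :
  (forall k, e <= Re (F k)) -> INR n * e <= Re (Csum F n).
Proof.
  intros H; induction n as [|n IH]; [simpl; lra|].
  rewrite S_INR; cbn [Csum]; rewrite re_plus; specialize (H n); lra.
Qed.

(** On [|z| <= r] every tail is dominated by the tail of the convergent series of [|c n| r^n],
    independently of [z]. The parameter [M0] lets the caller ask for enough terms. *)
Lemma pseries_uniform_tail (c : nat -> C) (P : C -> C) (r eps : R) (M0 : nat) :
  taylor_coeffs P c -> 0 <= r < 1 -> 0 < eps ->
  exists M, (M0 <= M)%nat /\ forall z, Cmod z <= r -> Cmod (P z - psum c z M)%C <= eps.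
Proof.
  intros HP Hr He.
  assert (HCV : Rbar_le 1 (CV_radius (fun n => Cmod (c n)))).
  { apply disk_pseries_CV_radius; intros y Hy; exists (P y); apply HP; exact Hy. }
  assert (E : ex_series (fun n => Cmod (c n) * r ^ n)).
  { apply (ex_series_ext (fun n => Rabs (Cmod (c n) * r ^ n))).
    - intros n; apply Rabs_pos_eq, Rmult_le_pos; [apply Cmod_ge_0|apply pow_le; lra].
    - apply (CV_disk_inside (fun n => Cmod (c n))). rewrite Rabs_pos_eq by lra.
      eapply Rbar_lt_le_trans; [|exact HCV]; simpl; lra. }
  assert (HL : is_lim_seq (sum_n (fun n => Cmod (c n) * r ^ n))
      (Series (fun n => Cmod (c n) * r ^ n))) by (apply Series_correct; exact E).
  apply is_lim_seq_spec in HL; destruct (HL (mkposreal _ He)) as [N HN].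
  set (u := fun n => Cmod (c n) * r ^ n) in *.
  assert (Hinc : forall n, sum_n u n <= Series u).
  { intros n; apply sum_n_le_Series; [|exact E].
    intros k; apply Rmult_le_pos; [apply Cmod_ge_0|apply pow_le; lra]. }
  exists (S (N + M0)); split; [lia|]. intros z Hz.
  set (m := (N + M0)%nat).
  assert (HM : Series u - sum_n u m <= eps).
  { specialize (HN m ltac:(unfold m; lia)); simpl in HN.
    apply Rabs_def2 in HN; lra. }
  apply Cconv_le with (N0 := S m) (s := fun n => (1 * psum c z n + - (1) * psum c z (S m))%C).
  - replace (P z - psum c z (S m))%C with (1 * P z + - (1) * psum c z (S m))%C by ring.
    apply Cconv_lin.
    + apply is_pseries_Cconv, HP; unfold in_disk; lra.
    + intros e Hpe; exists 0%nat; intros n _.  cbv beta.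
      replace (psum c z (S m) - psum c z (S m))%C with (RtoC 0) by ring. now rewrite Cmod_0.
  - intros n Hn; cbv beta.
    apply Rle_trans with (sum_n u (Nat.pred n) - sum_n u m).
    + induction Hn as [|n Hn IH].
      * simpl Nat.pred. right.
        replace (1 * psum c z (S m) + - (1) * psum c z (S m))%C with (RtoC 0) by ring.
        rewrite Cmod_0; ring.
      * destruct n as [|n]; [lia|]. simpl Nat.pred in *.
        rewrite sum_Sn; unfold plus; simpl AbelianMonoid.plus.
        change (psum c z (S (S n))) with (psum c z (S n) + c (S n) * z ^ (S n))%C.
        replace (1 * (psum c z (S n) + c (S n) * z ^ S n) + - (1) * psum c z (S m))%C
          with ((1 * psum c z (S n) + - (1) * psum c z (S m)) + c (S n) * z ^ S n)%C by ring.
        eapply Rle_trans; [apply Cmod_triangle|].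
        assert (Cmod (c (S n) * z ^ S n)%C <= u (S n)); [|lra].
        unfold u; rewrite Cmod_mult, Cmod_pow.
        apply Rmult_le_compat_l; [apply Cmod_ge_0|].
        apply pow_incr; split; [apply Cmod_ge_0|exact Hz].
    + specialize (Hinc (Nat.pred n)); lra.
Qed.

(** The Toeplitz form is first obtained on circles of radius [r < 1], where it is a cubic polynomial
    in [r]; this carries it to [r = 1]. *)
Lemma cubic_ge0_at_1 (A B D E : R) :
  (forall r, 0 <= r < 1 -> 0 <= A + B * r + D * r ^ 2 + E * r ^ 3) -> 0 <= A + B + D + E.
Proof.
  intros H; apply Rnot_lt_le; intros Hneg.
  (* The first three terms bound the slope on [[0,1]]. The 1 makes the value at [1 - h] strictly
     negative, and the last summand ensures [h <= 1]. *)
  set (K := Rabs B + 2 * Rabs D + 3 * Rabs E + 1 + - (A + B + D + E)).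
  assert (HB := Rabs_pos B). assert (HD := Rabs_pos D). assert (HE := Rabs_pos E).
  assert (HK : 0 < K) by (unfold K; lra).
  set (h := - (A + B + D + E) / K).
  assert (Hh : h * K = - (A + B + D + E)) by (unfold h; field; lra).
  assert (Hh0 : 0 < h) by (unfold h; apply Rdiv_lt_0_compat; lra).
  assert (Hh1 : h <= 1) by (unfold K in Hh; nra).
  specialize (H (1 - h) ltac:(lra)).
  assert (B1 := Rle_abs B). assert (B2 := Rle_abs (- B)). rewrite Rabs_Ropp in B2.
  assert (D1 := Rle_abs D). assert (D2 := Rle_abs (- D)). rewrite Rabs_Ropp in D2.
  assert (E1 := Rle_abs E). assert (E2 := Rle_abs (- E)). rewrite Rabs_Ropp in E2.
  assert (T1 : - B <= Rabs B) by lra.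
  assert (T2 : D * (h - 2) <= 2 * Rabs D) by nra.
  assert (T3 : E * (-3 + 3 * h - h ^ 2) <= 3 * Rabs E).
  { assert (0 <= 3 - 3 * h + h ^ 2 <= 3) by nra. nra. }
  assert (h * (- B + D * (h - 2) + E * (-3 + 3 * h - h ^ 2)) <= h * (Rabs B + 2 * Rabs D + 3 * Rabs E))
    by (apply Rmult_le_compat_l; lra).
  assert (A + B * (1 - h) + D * (1 - h) ^ 2 + E * (1 - h) ^ 3
    = (A + B + D + E) + h * (- B + D * (h - 2) + E * (-3 + 3 * h - h ^ 2))) by ring.
  unfold K in Hh. nra.
Qed.

(* The form is the limit of the averages of [P (r w) |x0 + x1 w + x2 w^2 + x3 w^3|^2]
   over the [N]-th roots of unity [w]; [P] is replaced by a partial sum so that the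
   average is exact by orthogonality once [N] exceeds all degrees. *)
Lemma toeplitz_nonneg (c : nat -> C) (P : C -> C) (x0 x1 x2 x3 : C) :
  taylor_coeffs P c -> (forall z, in_disk z -> 0 < Re (P z)) ->
  0 <= Re (c 0%nat * (x0 * Cconj x0 + x1 * Cconj x1 + x2 * Cconj x2 + x3 * Cconj x3)
         + c 1%nat * (x0 * Cconj x1 + x1 * Cconj x2 + x2 * Cconj x3)
         + c 2%nat * (x0 * Cconj x2 + x1 * Cconj x3)
         + c 3%nat * (x0 * Cconj x3))%C.
Proof.
  intros HP Hpos.
  set (F0 := (c 0%nat * (x0 * Cconj x0 + x1 * Cconj x1 + x2 * Cconj x2 + x3 * Cconj x3))%C).
  set (F1 := (c 1%nat * (x0 * Cconj x1 + x1 * Cconj x2 + x2 * Cconj x3))%C).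
  set (F2 := (c 2%nat * (x0 * Cconj x2 + x1 * Cconj x3))%C).
  set (F3 := (c 3%nat * (x0 * Cconj x3))%C).
  rewrite !re_plus; apply cubic_ge0_at_1; intros r Hr.
  set (Q := (Cmod x0 + Cmod x1 + Cmod x2 + Cmod x3) ^ 2).
  assert (HQ : 0 <= Q) by (unfold Q; apply pow2_ge_0).
  apply Rnot_lt_le; intros Hneg.
  set (V := Re F0 + Re F1 * r + Re F2 * r ^ 2 + Re F3 * r ^ 3) in *.
  (* If the form had a negative value [V], this truncation error would give [eps * Q < - V],
     contradicting the lower bound [- eps * Q] on the average. *)
  set (eps := - V / (Q + 1)).
  assert (He : 0 < eps) by (unfold eps; apply Rdiv_lt_0_compat; lra).
  assert (HeQ : eps * (Q + 1) = - V) by (unfold eps; field; lra).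
  destruct (pseries_uniform_tail c P r eps 4 HP Hr He) as [M [HM4 HM]].
  (* The test polynomial has degree 3, so this [N] satisfies the condition of [root_unity_coef] for
     all [i] and [j] up to 3. *)
  set (N := (M + 4)%nat).
  set (cr := fun n => (c n * RtoC r ^ n)%C).
  assert (Hcr : forall z, psum cr z M = psum c (RtoC r * z)%C M).
  { intros z; clear; induction M as [|M IH]; cbn [psum]; [reflexivity|].
    rewrite IH; unfold cr; rewrite Cpow_mult_l; ring. }
  assert (Hmod : forall k, Cmod (root_unity N ^ k)%C = 1).
  { intros k. assert (E := root_unity_unit N k). rewrite <- Cmod2_conj in E.
    apply RtoC_inj in E. assert (H0 := Cmod_ge_0 (root_unity N ^ k)%C). nra. }
  assert (Hlow : INR N * (- (eps * Q)) <= Re (Csum (fun k => psum cr (root_unity N ^ k)%C M *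
     ((x0 + x1 * root_unity N ^ k + x2 * (root_unity N ^ k) ^ 2 + x3 * (root_unity N ^ k) ^ 3)
     * Cconj (x0 + x1 * root_unity N ^ k + x2 * (root_unity N ^ k) ^ 2 + x3 * (root_unity N ^ k) ^ 3)))%C N)).
  { apply Re_Csum_ge; intros k.
    set (q := (x0 + _ + _ + _)%C).
    rewrite <- Cmod2_conj, re_scal_r.
    assert (Hq : Cmod q <= Cmod x0 + Cmod x1 + Cmod x2 + Cmod x3).
    { unfold q.
      eapply Rle_trans; [apply Cmod_triangle|apply Rplus_le_compat].
      eapply Rle_trans; [apply Cmod_triangle|apply Rplus_le_compat].
      eapply Rle_trans; [apply Cmod_triangle|apply Rplus_le_compat].
      all: rewrite ?Cmod_mult, ?(Cmod_pow (root_unity N ^ k)), ?Hmod, ?pow1; lra. }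
    assert (Hq2 : 0 <= Cmod q ^ 2 <= Q).
    { split; [apply pow2_ge_0|apply pow_incr; split; [apply Cmod_ge_0|exact Hq]]. }
    assert (Hz : Cmod (RtoC r * root_unity N ^ k)%C <= r).
    { rewrite Cmod_mult, Hmod, Cmod_R, Rabs_pos_eq; lra. }
    rewrite Hcr.
    (* [P] has positive real part and the partial sum is within [eps] of it, so the partial sum has
       real part at least [- eps]. *)
    assert (H1 := HM _ Hz).
    assert (H2 : 0 < Re (P (RtoC r * root_unity N ^ k)%C)) by (apply Hpos; unfold in_disk; lra).
    assert (H3 := re_le_Cmod (P (RtoC r * root_unity N ^ k) - psum c (RtoC r * root_unity N ^ k) M)%C).
    unfold Cminus in H3; rewrite re_plus, re_opp in H3.
    fold (Cminus (P (RtoC r * root_unity N ^ k)%C) (psum c (RtoC r * root_unity N ^ k)%C M)) in H3.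
    assert (H4 := Rle_trans _ _ _ H3 H1).
    apply Rabs_le_between in H4. nra. }
  assert (Eform : Csum (fun k => psum cr (root_unity N ^ k)%C M *
     ((x0 + x1 * root_unity N ^ k + x2 * (root_unity N ^ k) ^ 2 + x3 * (root_unity N ^ k) ^ 3)
     * Cconj (x0 + x1 * root_unity N ^ k + x2 * (root_unity N ^ k) ^ 2 + x3 * (root_unity N ^ k) ^ 3)))%C N
     = (RtoC (INR N) * (F0 + RtoC r * F1 + RtoC r ^ 2 * F2 + RtoC r ^ 3 * F3))%C).
  { rewrite (Csum_quad_expand (fun k => psum cr (root_unity N ^ k)%C M) (fun k => root_unity N ^ k)%C).
    rewrite !root_unity_coef by (unfold N; lia).
    cbn [Nat.leb Nat.sub].
    assert (L : forall m, (m < 4)%nat -> Nat.ltb m M = true)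
      by (intros m Hm; apply Nat.ltb_lt; lia).
    rewrite !L by lia.
    unfold cr, F0, F1, F2, F3. generalize (RtoC (INR N)); intros; cbn [Cpow]; ring. }
  rewrite Eform, re_scal_l, !re_plus in Hlow.
  rewrite <- !RtoC_pow, !re_scal_l in Hlow.
  assert (HN : 0 < INR N) by (apply lt_0_INR; unfold N; lia).
  apply Rmult_le_reg_l in Hlow; [|exact HN].
  unfold V in *; nra.
Qed.

(** * Coefficient inequalities from the Toeplitz form *)

(** The choice [u = - X / |X|] turns [Re (conj u * X)] into [- |X|]. The test vectors below carry a
    free unimodular [u] for this purpose. *)
Lemma Cmod_le_phase (X : C) (K : R) :
  (forall u : C, (u * Cconj u)%C = 1%C -> 0 <= K + Re (Cconj u * X)%C) -> Cmod X <= K.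
Proof.
  intros H; destruct (Ceq_dec X 0%C) as [->|HX].
  - rewrite Cmod_0. specialize (H 1%C). rewrite Cmult_0_r in H; simpl in H.
    rewrite Rplus_0_r in H; apply H. unfold Cconj, Cmult, RtoC; simpl; f_equal; ring.
  - apply Cmod_gt_0 in HX.
    assert (E : (X * Cconj X)%C = RtoC (Cmod X * Cmod X)).
    { rewrite <- Cmod2_conj; f_equal; ring. }
    specialize (H (RtoC (- / Cmod X) * X)%C).
    assert (Cr : forall r, Cconj (RtoC r) = RtoC r)
      by (intros r; unfold Cconj, RtoC; simpl; f_equal; ring).
    rewrite Cmult_conj, Cr in H.
    replace (RtoC (- / Cmod X) * X * (RtoC (- / Cmod X) * Cconj X))%C
      with (RtoC (- / Cmod X) * RtoC (- / Cmod X) * (X * Cconj X))%C in H by ring.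
    replace (RtoC (- / Cmod X) * Cconj X * X)%C
      with (RtoC (- / Cmod X) * (X * Cconj X))%C in H by ring.
    rewrite E, <- !RtoC_mult, re_RtoC in H.
    replace (- / Cmod X * (Cmod X * Cmod X)) with (- Cmod X) in H by (field; lra).
    enough (0 <= K + - Cmod X) by lra.
    apply H; f_equal; field; lra.
Qed.

(** The real part is half the Hermitian form of the Toeplitz matrix with diagonal 2, entries [p1],
    [p2], [p3] on one side and their conjugates on the other. *)
Definition toeplitz_psd (p1 p2 p3 : C) : Prop := forall x0 x1 x2 x3 : C,
  0 <= Re (1 * (x0 * Cconj x0 + x1 * Cconj x1 + x2 * Cconj x2 + x3 * Cconj x3)
         + p1 * (x0 * Cconj x1 + x1 * Cconj x2 + x2 * Cconj x3)
         + p2 * (x0 * Cconj x2 + x1 * Cconj x3)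
         + p3 * (x0 * Cconj x3))%C.

Ltac to_components :=
  repeat match goal with x : C |- _ => destruct x end;
  unfold Cminus, Cconj, Cmult, Cplus, Copp, RtoC, Re, Im; cbn [fst snd].

(* [c1], [c2], [c3] are the coefficients of the Schwarz function [w] with
   [p = (1 + w) / (1 - w)]. *)
Definition schur_coeffs (c1 c2 c3 : C) : Prop :=
  toeplitz_psd (2 * c1) (2 * (c2 + c1 * c1)) (2 * (c3 + 2 * (c1 * c2) + c1 * (c1 * c1))).

Lemma Cmod_sqr (z : C) : Cmod z ^ 2 = Re z * Re z + Im z * Im z.
Proof. rewrite Cmod2_alt; ring. Qed.

Lemma unit_components (u : C) : (u * Cconj u)%C = 1%C -> Re u * Re u + Im u * Im u = 1.
Proof.
  intros E; apply (f_equal Re) in E; rewrite re_mult, re_conj, im_conj in E.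
  simpl in E; lra.
Qed.

(** The test polynomial is [1 + u z] with [|u| = 1], on which the form equals
    [2 + 2 Re (conj u * c1)]. *)
Lemma schur_c1 (c1 c2 c3 : C) : schur_coeffs c1 c2 c3 ->
  Cmod c1 <= 1.
Proof.
  intros H; apply Cmod_le_phase; intros u Hu; apply unit_components in Hu.
  assert (T := H 1%C u 0%C 0%C). clear H.
  enough (0 <= (1 + (Re u * Re u + Im u * Im u)) + 2 * Re (Cconj u * c1)%C) by lra.
  eapply Rle_trans; [exact T|right]. clear; to_components; ring.
Qed.

(* With [<z^i, z^j> = p_(j-i) / 2], the polynomials [1 - c1 z] and [z^2 - conj c1 z]
   have squared norm [1 - |c1|^2] and inner product [c2]; test their combinations. *)
Lemma schur_c2 (c1 c2 c3 : C) : schur_coeffs c1 c2 c3 ->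
  Cmod c2 <= 1 - Cmod c1 ^ 2.
Proof.
  intros H; apply Cmod_le_phase; intros u Hu; apply unit_components in Hu.
  assert (T := H 1%C (- c1 - u * Cconj c1)%C u 0%C). clear H.
  enough (0 <= (1 + (Re u * Re u + Im u * Im u)) * (1 - Cmod c1 ^ 2)
               + 2 * Re (Cconj u * c2)%C) by (rewrite Hu in *; lra).
  rewrite Cmod_sqr.
  eapply Rle_trans; [exact T|right]. clear; to_components; ring.
Qed.

(** The test vectors control [c3 + conj c1 * c2^2 / 4] by [1 - |c1|^2 - 3/4 |c2|^2]. Removing the
    extra term costs at most [|c2|^2 / 4], since [|c1| <= 1]. *)
Lemma schur_c3 (c1 c2 c3 : C) : schur_coeffs c1 c2 c3 ->
  Cmod c3 <= 1 - Cmod c1 ^ 2 - Cmod c2 ^ 2 / 2.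
Proof.
  intros H.
  assert (HX : Cmod (c3 + RtoC (/ 4) * Cconj c1 * (c2 * c2))%C
               <= 1 - Cmod c1 ^ 2 - 3 / 4 * Cmod c2 ^ 2).
  (* Test [1 - c1 z - (c2/2) z^2] against [z^3 - conj c1 z^2 - (conj c2/2) z]. *)
  { apply Cmod_le_phase; intros u Hu; apply unit_components in Hu.
    assert (T := H 1%C (- c1 - RtoC (/ 2) * (u * Cconj c2))%C
                  (- (RtoC (/ 2) * c2) - u * Cconj c1)%C u). clear H.
    set (X := (c3 + _)%C).
    enough (0 <= (1 + (Re u * Re u + Im u * Im u)) * (1 - Cmod c1 ^ 2 - 3 / 4 * Cmod c2 ^ 2)
                 + 2 * Re (Cconj u * X)%C) by (rewrite Hu in *; lra).
    rewrite !Cmod_sqr; unfold X; clear X.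
    eapply Rle_trans; [exact T|right]. clear; to_components; field. }
  assert (T := Cmod_triangle (c3 + RtoC (/ 4) * Cconj c1 * (c2 * c2))
                 (- (RtoC (/ 4) * Cconj c1 * (c2 * c2)))).
  replace (c3 + RtoC (/ 4) * Cconj c1 * (c2 * c2)
    + - (RtoC (/ 4) * Cconj c1 * (c2 * c2)))%C with c3 in T by ring.
  rewrite Cmod_opp, !Cmod_mult, Cmod_conj, Cmod_R, Rabs_pos_eq in T by lra.
  assert (L := schur_c1 c1 c2 c3 H).
  assert (0 <= Cmod c1) by apply Cmod_ge_0.
  assert (0 <= (1 - Cmod c1) * (Cmod c2 * Cmod c2))
    by (apply Rmult_le_pos; [lra|apply Rle_0_sqr]).
  nra.
Qed.

(** The loss [- |c1|^2] in the bound on [|c2|] absorbs [m |c1|^2]. *)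
Lemma schur_quadratic (c1 c2 c3 : C) (m : R) : schur_coeffs c1 c2 c3 ->
  0 <= m <= 1 -> Cmod (c2 + RtoC m * (c1 * c1))%C <= 1.
Proof.
  intros H Hm. eapply Rle_trans; [apply Cmod_triangle|].
  rewrite !Cmod_mult, Cmod_R, Rabs_pos_eq by lra.
  assert (L2 := schur_c2 c1 c2 c3 H). assert (0 <= Cmod c1 * Cmod c1) by apply Rle_0_sqr. nra.
Qed.

(** With [x = |c1|] and [y = |c2|], the three terms add up to at most [1 - x^2 - y^2/2 + x y + x^2/2
    = 1 - (x - y)^2 / 2]. *)
Lemma schur_cubic (c1 c2 c3 : C) (m n : R) : schur_coeffs c1 c2 c3 ->
  0 <= m <= 1 -> 0 <= n <= / 2 ->
  Cmod (c3 + RtoC m * (c1 * c2) + RtoC n * (c1 * (c1 * c1)))%C <= 1.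
Proof.
  intros H Hm Hn.
  eapply Rle_trans; [apply Cmod_triangle|].
  eapply Rle_trans; [apply Rplus_le_compat_r, Cmod_triangle|].
  rewrite !Cmod_mult, !Cmod_R, !Rabs_pos_eq by lra.
  assert (L1 := schur_c1 c1 c2 c3 H). assert (L3 := schur_c3 c1 c2 c3 H).
  assert (Hx := Cmod_ge_0 c1). assert (Hy := Cmod_ge_0 c2).
  set (x := Cmod c1) in *; set (y := Cmod c2) in *.
  assert (m * (x * y) <= 1 * (x * y)) 
    by (apply Rmult_le_compat_r; [apply Rmult_le_pos; assumption|lra]).
  assert (n * (x * (x * x)) <= / 2 * (x * x)).
  { assert (0 <= x * x) by apply Rle_0_sqr.
    assert (x * (x * x) <= 1 * (x * x)) by (apply Rmult_le_compat_r; lra).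
    apply Rmult_le_compat; try lra. apply Rmult_le_pos; lra. }
  assert (0 <= (x - y) * (x - y)) by apply Rle_0_sqr.
  lra.
Qed.

(** * Bounds for the logarithmic coefficients *)

Definition carath_coef (beta : R) (a : nat -> C) (n : nat) : C :=
  (RtoC (INR (S n) - INR n * beta) * a (S n))%C.

Lemma pseries_coeff_0 (a : nat -> C) (l : C) :
  @is_pseries C_AbsRing C_NormedModule a (RtoC 0) l -> l = a 0%nat.
Proof.
  intros Hl; apply (Cconv_unique (psum a (RtoC 0))); apply is_pseries_Cconv; [exact Hl|].
  apply (@is_pseries_0 C_AbsRing C_NormedModule a).
Qed.

Lemma class_A_normalization (f : C -> C) (a : nat -> C) :
  class_A f -> taylor_coeffs f a -> a 0%nat = 0%C /\ a 1%nat = 1%C.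
Proof.
  intros [_ [H0 H1]] Hf.
  assert (D0 : in_disk (RtoC 0)) by (unfold in_disk; rewrite Cmod_0; lra).
  split.
  - rewrite <- H0; symmetry; apply pseries_coeff_0, Hf, D0.
  - destruct (taylor_coeffs_derive f a _ Hf D0) as [g [Hg Hs]].
    apply pseries_coeff_0 in Hs.
    apply is_C_derive_unique in Hg; apply is_C_derive_unique in H1.
    rewrite Hg, Hs in H1; unfold Cderiv_coef in H1.
    change (INR 1) with 1 in H1. rewrite <- H1; ring.
Qed.

Lemma quot_z_pseries (f : C -> C) (a : nat -> C) (z : C) :
  taylor_coeffs f a -> a 0%nat = 0%C -> a 1%nat = 1%C -> in_disk z ->
  @is_pseries C_AbsRing C_NormedModule (fun n => a (S n)) z (quot_z f z).
Proof.
  intros Hf H0 H1 Hz; unfold quot_z; destruct (Ceq_dec z 0%C) as [->|Hne].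
  - rewrite <- H1. apply (@is_pseries_0 C_AbsRing C_NormedModule (fun n => a (S n))).
  - assert (E : forall n, (z * psum (fun n => a (S n)) z n)%C = psum a z (S n)).
    { intros n; induction n as [|n IH].
      - cbn [psum]; rewrite H0; ring.
      - cbn [psum]. rewrite Cmult_plus_distr_l, IH. cbn [psum Cpow]; ring. }
    assert (L : Cconv (fun n => psum a z (n + 1)) (f z)).
    { eapply Cconv_shift; [reflexivity|]. apply is_pseries_Cconv, Hf, Hz. }
    apply is_pseries_Cconv.
    (* The zero summand only gives the limit the shape required by [Cconv_lin]. *)
    replace (f z / z)%C with (/ z * f z + 0 * f z)%C by (unfold Cdiv; ring).
    apply (Cconv_shift (fun n => / z * psum a z (n + 1) + 0 * psum a z (n + 1))%C _ _ 0).
    + intros n. replace (n + 0 + 1)%nat with (S n) by lia. rewrite <- E.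
      field; exact Hne.
    + apply Cconv_lin; exact L.
Qed.

Lemma carath_pseries (beta : R) (f : C -> C) (a : nat -> C) (z f' : C) :
  taylor_coeffs f a -> a 0%nat = 0%C -> a 1%nat = 1%C -> in_disk z ->
  @is_derive C_AbsRing C_NormedModule f z f' ->
  @is_pseries C_AbsRing C_NormedModule (carath_coef beta a) z
    (RtoC beta * quot_z f z + RtoC (1 - beta) * f')%C.
Proof.
  intros Hf H0 H1 Hz Hd.
  destruct (taylor_coeffs_derive f a z Hf Hz) as [g [Hg Hs]].
  apply is_C_derive_unique in Hg; apply is_C_derive_unique in Hd.
  rewrite Hg in Hd; subst f'.
  apply is_pseries_Cconv.
  apply (Cconv_shift (fun n => RtoC beta * psum (fun n => a (S n)) z n
           + RtoC (1 - beta) * psum (Cderiv_coef a) z n)%C _ _ 0).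
  - intros n; rewrite Nat.add_0_r; induction n as [|n IH]; cbn [psum]; [ring|].
    rewrite IH; unfold carath_coef, Cderiv_coef.
    replace (INR (S n) - INR n * beta) with (beta + (1 - beta) * INR (S n))
      by (rewrite S_INR; ring).
    rewrite RtoC_plus, RtoC_mult; ring.
  - apply Cconv_lin; apply is_pseries_Cconv; [now apply quot_z_pseries|exact Hs].
Qed.

Lemma RtoC_pos_neq_0 (d : R) : 0 < d -> RtoC d <> 0%C.
Proof. intros Hd E; apply RtoC_inj in E; lra. Qed.

(** Comparing coefficients in [(1 - w) p = 1 + w] gives a triangular system for [c1], [c2], [c3].
    Solving it suffices; the function [w] itself is never constructed. *)
Lemma class_A_beta_schur (beta : R) (f : C -> C) (a : nat -> C) :
  class_A_beta beta f -> taylor_coeffs f a ->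
  exists c1 c2 c3, schur_coeffs c1 c2 c3
    /\ (2 * c1)%C = carath_coef beta a 1
    /\ (2 * (c2 + c1 * c1))%C = carath_coef beta a 2
    /\ (2 * (c3 + 2 * (c1 * c2) + c1 * (c1 * c1)))%C = carath_coef beta a 3.
Proof.
  intros [HA Hpos] Hf.
  destruct (class_A_normalization f a HA Hf) as [H0 H1].
  destruct HA as [Hholo _].
  set (P := fun z => (RtoC beta * quot_z f z + RtoC (1 - beta) * C_derive f z)%C).
  assert (HD : forall z, in_disk z ->
    @is_derive C_AbsRing C_NormedModule f z (C_derive f z)).
  { intros z Hz; apply C_derive_correct; [exact z|apply Hholo, Hz]. }
  assert (HP : taylor_coeffs P (carath_coef beta a)).
  { intros z Hz; apply carath_pseries; auto. }
  assert (HPpos : forall z, in_disk z -> 0 < Re (P z)).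
  { intros z Hz; apply Hpos; auto. }
  set (c1 := (/ 2 * carath_coef beta a 1)%C).
  set (c2 := (/ 2 * carath_coef beta a 2 - c1 * c1)%C).
  set (c3 := (/ 2 * carath_coef beta a 3 - 2 * (c1 * c2) - c1 * (c1 * c1))%C).
  assert (N2 : RtoC 2 <> 0%C) by (apply RtoC_pos_neq_0; lra).
  assert (E1 : (2 * c1)%C = carath_coef beta a 1) by (unfold c1; field; exact N2).
  assert (E2 : (2 * (c2 + c1 * c1))%C = carath_coef beta a 2)
    by (unfold c2; field; exact N2).
  assert (E3 : (2 * (c3 + 2 * (c1 * c2) + c1 * (c1 * c1)))%C = carath_coef beta a 3)
    by (unfold c3; field; exact N2).
  exists c1, c2, c3; split; [|auto].
  intros x0 x1 x2 x3.
  rewrite E1, E2, E3.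
  assert (T := toeplitz_nonneg (carath_coef beta a) P x0 x1 x2 x3 HP HPpos).
  replace (carath_coef beta a 0) with (RtoC 1) in T; [exact T|].
  unfold carath_coef; rewrite H1; simpl INR.
  rewrite Rmult_0_l, Rminus_0_r; ring.
Qed.

Lemma carath_factor_ge_1 (beta : R) (n : nat) :
  0 <= beta <= 1 -> 1 <= INR (S n) - INR n * beta.
Proof. intros Hb; rewrite S_INR; assert (H := pos_INR n); nra. Qed.

Lemma Cmod_scal_inv (d : R) (X : C) : 0 < d -> Cmod X <= 1 -> Cmod (RtoC (/ d) * X)%C <= 1 / d.
Proof.
  intros Hd HX; assert (0 < / d) by now apply Rinv_0_lt_compat.
  rewrite Cmod_mult, Cmod_R, Rabs_pos_eq by lra.
  unfold Rdiv; rewrite Rmult_1_l. rewrite <- (Rmult_1_r (/ d)) at 2.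
  apply Rmult_le_compat_l; lra.
Qed.

Lemma gamma_bound (beta : R) (f : C -> C) (a : nat -> C) (m : nat) :
  0 <= beta <= 1 -> class_A_beta beta f -> taylor_coeffs f a -> (1 <= m <= 3)%nat ->
  Cmod (gamma a m) <= 1 / (INR (m + 1) - INR m * beta).
Proof.
  intros Hb HA Hf Hm.
  destruct (class_A_beta_schur beta f a HA Hf) as (c1 & c2 & c3 & HS & E1 & E2 & E3).
  unfold carath_coef in E1, E2, E3.
  (* In terms of [s] the factors become [1 + s], [1 + 2 s] and [1 + 3 s], with [0 <= s <= 1]. *)
  set (s := 1 - beta).
  assert (Hs : 0 <= s <= 1) by (unfold s; lra).
  replace (INR 2 - INR 1 * beta) with (1 + s) in E1 by (unfold s; simpl; ring).
  replace (INR 3 - INR 2 * beta) with (1 + 2 * s) in E2 by (unfold s; simpl; ring).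
  replace (INR 4 - INR 3 * beta) with (1 + 3 * s) in E3 by (unfold s; simpl; ring).
  assert (Hd : INR (m + 1) - INR m * beta = 1 + INR m * s)
    by (unfold s; rewrite plus_INR; simpl; ring).
  rewrite Hd; clear Hd.
  assert (N2 := RtoC_pos_neq_0 2 ltac:(lra)). assert (N3 := RtoC_pos_neq_0 3 ltac:(lra)).
  assert (D1 := RtoC_pos_neq_0 (1 + s) ltac:(lra)). assert (D2 := RtoC_pos_neq_0 (1 + 2 * s) ltac:(lra)).
  assert (D3 := RtoC_pos_neq_0 (1 + 3 * s) ltac:(lra)).
  assert (A2 : a 2%nat = (2 * c1 / RtoC (1 + s))%C) by (rewrite E1; field; exact D1).
  assert (A3 : a 3%nat = (2 * (c2 + c1 * c1) / RtoC (1 + 2 * s))%C)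
    by (rewrite E2; field; exact D2).
  assert (A4 : a 4%nat = (2 * (c3 + 2 * (c1 * c2) + c1 * (c1 * c1)) / RtoC (1 + 3 * s))%C)
    by (rewrite E3; field; exact D3).
  clear E1 E2 E3.
  assert (P1 : 0 < 1 + s) by lra. assert (P2 : 0 < 1 + 2 * s) by lra.
  assert (P3 : 0 < 1 + 3 * s) by lra.
  destruct m as [|[|[|[|m]]]]; try lia; unfold gamma.
  - replace (/ 2 * a 2%nat)%C with (RtoC (/ (1 + s)) * c1)%C.
    + simpl INR; rewrite Rmult_1_l; apply Cmod_scal_inv; [lra|eapply schur_c1, HS].
    + rewrite A2, RtoC_inv by lra; field; auto.
  (* This is the coefficient of [c1^2] in [(1 + 2 s) gamma_2]; it simplifies to
     [s^2 / (1 + s)^2]. *)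
  - set (t := 1 - (1 + 2 * s) / ((1 + s) * (1 + s))).
    replace (/ 2 * (a 3%nat - / 2 * a 2%nat ^ 2))%C
      with (RtoC (/ (1 + 2 * s)) * (c2 + RtoC t * (c1 * c1)))%C.
    + replace (INR 2) with 2 by (simpl; ring).
      apply Cmod_scal_inv; [lra|eapply schur_quadratic; [exact HS|]].
      unfold t; replace (1 - (1 + 2 * s) / ((1 + s) * (1 + s))) with (s * s / ((1 + s) * (1 + s)))
        by (field; lra).
      assert (0 < (1 + s) * (1 + s)) by nra.
      split; [apply Rdiv_le_0_compat; nra|].
      apply Rle_div_l; nra.
    + unfold t; rewrite A2, A3, RtoC_inv, RtoC_minus, RtoC_div, !(RtoC_mult (1 + s)) by nra.
      cbn [Cpow]; field; auto.
  (* [t] and [v] are the coefficients of [c1 c2] and [c1^3] in [(1 + 3 s) gamma_3]. *)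
  - set (t := 2 - 2 * (1 + 3 * s) / ((1 + s) * (1 + 2 * s))).
    set (v := 1 - 2 * (1 + 3 * s) / ((1 + s) * (1 + 2 * s))
              + 4 * (1 + 3 * s) / (3 * ((1 + s) * (1 + s) * (1 + s)))).
    replace (/ 2 * (a 4%nat - a 2%nat * a 3%nat + / 3 * a 2%nat ^ 3))%C
      with (RtoC (/ (1 + 3 * s)) * (c3 + RtoC t * (c1 * c2) + RtoC v * (c1 * (c1 * c1))))%C.
    + replace (INR 3) with 3 by (simpl; ring).
      apply Cmod_scal_inv; [lra|eapply schur_cubic; [exact HS| |]].
      * unfold t; replace (2 - 2 * (1 + 3 * s) / ((1 + s) * (1 + 2 * s)))
          with (4 * s * s / ((1 + s) * (1 + 2 * s))) by (field; lra).
        assert (0 < (1 + s) * (1 + 2 * s)) by nra.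
        split; [apply Rdiv_le_0_compat; nra|].
        apply Rle_div_l; nra.
      * unfold v.
        replace (1 - 2 * (1 + 3 * s) / ((1 + s) * (1 + 2 * s))
                 + 4 * (1 + 3 * s) / (3 * ((1 + s) * (1 + s) * (1 + s))))
          with ((1 + 5 * s + 9 * s ^ 2 + 3 * s ^ 3 + 6 * s ^ 4)
                / (3 * ((1 + s) * (1 + s) * (1 + s)) * (1 + 2 * s))) by (field; lra).
        assert (H1 : 0 < (1 + s) * (1 + s) * (1 + s)) by (repeat apply Rmult_lt_0_compat; lra).
        assert (H2 : 0 < 3 * ((1 + s) * (1 + s) * (1 + s)) * (1 + 2 * s))
          by (repeat apply Rmult_lt_0_compat; lra).
        assert (H3 : 0 <= s ^ 3) by (apply pow_le; lra).
        assert (H4 : 0 <= s ^ 4 <= s ^ 3)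
          by (split; [apply pow_le; lra|replace (s ^ 4) with (s * s ^ 3) by ring; nra]).
        assert (H5 : 0 <= s ^ 2) by (apply pow_le; lra).
        split; [apply Rdiv_le_0_compat; lra|].
        apply Rle_div_l; [lra|].
        (* This is half the denominator of [v] minus its numerator; [s^4 <= s^3] makes it
           nonnegative. *)
        assert (0 <= / 2 * (1 + 5 * s + 9 * s ^ 2 + 15 * s ^ 3 - 6 * s ^ 4)) by lra.
        nra.
    + unfold t, v; set (d1 := 1 + s) in *; set (d2 := 1 + 2 * s) in *; set (d3 := 1 + 3 * s) in *.
      (* The identity holds for arbitrary nonzero [d1], [d2], [d3], so their link to [s] can be
         forgotten. *)
      clearbody d1 d2 d3.
      assert (d1 * d2 <> 0) by nra.
      assert (3 * (d1 * d1 * d1) <> 0) by (assert (0 < d1 * d1 * d1); [repeat apply Rmult_lt_0_compat|]; lra).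
      rewrite A2, A3, A4, RtoC_inv, RtoC_plus, !RtoC_minus, !RtoC_div, !RtoC_mult by lra.
      replace (RtoC 4) with (2 * 2)%C by (rewrite <- RtoC_mult; f_equal; ring).
      cbn [Cpow]; field; auto.
Qed.

(** * Extremal functions *)

(** These are the Taylor coefficients of [(1 + z^m)/(1 - z^m) = 1 + 2 z^m + 2 z^(2m) + ...]. *)
Definition ext_carath (m n : nat) : R :=
  if Nat.eq_dec n 0 then 1 else if Nat.eq_dec (n mod m) 0 then 2 else 0.

(** Dividing by [n + 1 - n beta] inverts [carath_coef], which solves [beta f/z + (1 - beta) f' = (1
    + z^m)/(1 - z^m)] coefficientwise. *)
Definition ext_coef (beta : R) (m n : nat) : C :=
  match n with
  | O => 0%C
  | S k => RtoC (ext_carath m k / (INR (S k) - INR k * beta))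
  end.

Definition ext_fun (beta : R) (m : nat) (z : C) : C :=
  @iota (CompleteNormedModule.CompleteSpace C_AbsRing C_CompleteNormedModule)
    (@is_pseries C_AbsRing C_NormedModule (ext_coef beta m) z).

Lemma ext_carath_bound (m n : nat) : 0 <= ext_carath m n <= 2.
Proof. unfold ext_carath; destruct (Nat.eq_dec n 0), (Nat.eq_dec (n mod m) 0); lra. Qed.

Lemma ext_coef_bound (beta : R) (m n : nat) : 0 <= beta <= 1 -> Cmod (ext_coef beta m n) <= 2.
Proof.
  intros Hb; destruct n as [|n]; unfold ext_coef.
  - rewrite Cmod_0; lra.
  - assert (H := ext_carath_bound m n). assert (Hd := carath_factor_ge_1 beta n Hb).
    rewrite Cmod_R, Rabs_pos_eq by (apply Rdiv_le_0_compat; lra).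
    apply Rle_div_l; lra.
Qed.

Lemma ext_fun_taylor (beta : R) (m : nat) :
  0 <= beta <= 1 -> taylor_coeffs (ext_fun beta m) (ext_coef beta m).
Proof.
  intros Hb z Hz; unfold in_disk in Hz.
  assert (E : @ex_series C_AbsRing C_NormedModule
    (fun k => scal (pow_n (z : C_AbsRing) k) (ext_coef beta m k))).
  { apply (@ex_series_le C_AbsRing C_CompleteNormedModule _ (fun n => 2 * Cmod z ^ n)).
    - intros n.
      change (Cmod (pow_n (K := C_Ring) z n * ext_coef beta m n)%C <= 2 * Cmod z ^ n).
      rewrite pow_n_Cpow, Cmod_mult, Cmod_pow, Rmult_comm.
      apply Rmult_le_compat_r; [apply pow_le, Cmod_ge_0|now apply ext_coef_bound].
    - apply (@ex_series_scal R_AbsRing R_NormedModule 2), ex_series_geom.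
      rewrite Rabs_pos_eq by apply Cmod_ge_0; exact Hz. }
  destruct E as [l Hl].
  unfold ext_fun.
  apply (@iota_correct C_AbsRing C_CompleteNormedModule
           (@is_pseries C_AbsRing C_NormedModule (ext_coef beta m) z)).
  exists l; split; [exact Hl|].
  intros l' Hl'; eapply Cconv_unique; apply is_pseries_Cconv; eassumption.
Qed.

(** The partial sums stay constant between multiples of [m]. At the indices [S (n * m)] their
    product with [1 - z^m] telescopes to [1 + z^m - 2 z^(m (n + 1))], whose last term tends to 0. *)
Lemma ext_carath_series (m : nat) (z p : C) : (0 < m)%nat -> in_disk z ->
  Cconv (psum (fun n => RtoC (ext_carath m n)) z) p ->
  ((1 - z ^ m) * p = 1 + z ^ m)%C.
Proof.
  intros Hm Hz Hp; unfold in_disk in Hz.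
  set (b := fun n => RtoC (ext_carath m n)) in *.
  assert (Hgap : forall n j, (j < m)%nat -> psum b z (S (n * m) + j) = psum b z (S (n * m))).
  { intros n j; induction j as [|j IH]; intros Hj; [now rewrite Nat.add_0_r|].
    rewrite Nat.add_succ_r, psum_S, IH by lia.
    replace (b (S (n * m) + j)%nat) with (RtoC 0); [ring|].
    unfold b, ext_carath.
    replace (S (n * m) + j)%nat with (S j + n * m)%nat by lia.
    rewrite Nat.Div0.mod_add, Nat.mod_small by lia.
    destruct (Nat.eq_dec (S j + n * m) 0); [lia|].
    destruct (Nat.eq_dec (S j) 0); [lia|reflexivity]. }
  assert (Hclosed : forall n,
    ((1 - z ^ m) * psum b z (S (n * m)) = 1 + z ^ m - 2 * (z ^ m) ^ (S n))%C).
  { intros n; induction n as [|n IH].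
    - simpl Nat.mul; cbn [psum]. change (b 0%nat) with (RtoC 1). cbn [Cpow].
      replace (RtoC 2) with (1 + 1)%C by (rewrite <- RtoC_plus; reflexivity). ring.
    - replace (S (S n * m)) with (S (S (n * m) + (m - 1))) by lia.
      rewrite psum_S, Hgap by lia.
      rewrite Cmult_plus_distr_l, IH.
      replace (S (n * m) + (m - 1))%nat with (m * S n)%nat by lia.
      rewrite (Cpow_mult_r z m (S n)).
      replace (b (m * S n)%nat) with (RtoC 2); [cbn [Cpow]; ring|].
      unfold b, ext_carath. rewrite (Nat.mul_comm m), Nat.Div0.mod_mul.
      destruct (Nat.eq_dec (S n * m) 0); [lia|reflexivity]. }
  apply (Cconv_unique (fun n => (1 - z ^ m) * psum b z (S (n * m)) + 0 * psum b z (S (n * m)))%C).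
  - replace ((1 - z ^ m) * p)%C with ((1 - z ^ m) * p + 0 * p)%C by ring.
    assert (L : Cconv (fun n => psum b z (S (n * m))) p).
    { intros e He; destruct (Hp e He) as [N HN]; exists N; intros n Hn; apply HN; nia. }
    now apply Cconv_lin.
  - intros e He.
    assert (Hw : Cmod (z ^ m)%C < 1).
    { rewrite Cmod_pow; apply pow_lt_1_compat; [split; [apply Cmod_ge_0|exact Hz]|exact Hm]. }
    destruct (pow_lt_1_zero (Cmod (z ^ m)%C)
      ltac:(rewrite Rabs_pos_eq by apply Cmod_ge_0; exact Hw) (e / 2) ltac:(lra)) as [N HN].
    exists N; intros n Hn; cbv beta. rewrite Hclosed.
    replace (1 + z ^ m - 2 * (z ^ m) ^ S n + 0 * psum b z (S (n * m)) - (1 + z ^ m))%C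
      with (- (RtoC 2 * (z ^ m) ^ S n))%C by ring.
    rewrite Cmod_opp, Cmod_mult, Cmod_R, Rabs_pos_eq, Cmod_pow by lra.
    specialize (HN (S n) ltac:(lia)).
    rewrite Rabs_pos_eq in HN by (apply pow_le, Cmod_ge_0). lra.
Qed.

(** Multiplying the equation by the conjugate of [1 - w] and taking real parts gives
    [Re p * |1 - w|^2 = 1 - |w|^2 > 0]. *)
Lemma cayley_Re_pos (w p : C) : Cmod w < 1 -> ((1 - w) * p = 1 + w)%C -> 0 < Re p.
Proof.
  intros Hw E.
  assert (Hw2 : Re w * Re w + Im w * Im w < 1).
  { rewrite <- Cmod_sqr. assert (H := Cmod_ge_0 w). nra. }
  assert (ER := f_equal Re E). assert (EI := f_equal Im E).
  destruct w as [x y], p as [a b].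
  unfold Cminus, Cmult, Cplus, Copp, RtoC, Re, Im in *; cbn [fst snd] in *.
  assert (K : a * ((1 - x) * (1 - x) + y * y) = 1 - (x * x + y * y)).
  { transitivity ((1 - x) * ((1 + - x) * a - (0 + - y) * b)
                  + - y * ((1 + - x) * b + (0 + - y) * a)); [ring|].
    rewrite ER, EI; ring. }
  apply Rnot_le_lt; intros Ha.
  assert (0 <= (1 - x) * (1 - x) + y * y) by nra.
  nra.
Qed.

Lemma ext_fun_class (beta : R) (m : nat) :
  0 <= beta <= 1 -> (0 < m)%nat -> class_A_beta beta (ext_fun beta m).
Proof.
  intros Hb Hm.
  assert (HT := ext_fun_taylor beta m Hb).
  assert (D0 : in_disk (RtoC 0)) by (unfold in_disk; rewrite Cmod_0; lra).
  assert (H1 : ext_coef beta m 1 = 1%C).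
  { change (RtoC (1 / (1 - 0 * beta)) = RtoC 1); f_equal; field; lra. }
  split; [split; [|split]|].
  - intros z Hz; destruct (taylor_coeffs_derive _ _ z HT Hz) as [g [Hg _]].
    exists g; exact Hg.
  - apply (pseries_coeff_0 (ext_coef beta m)), HT, D0.
  - destruct (taylor_coeffs_derive _ _ _ HT D0) as [g [Hg Hs]].
    apply pseries_coeff_0 in Hs. unfold Cderiv_coef in Hs; rewrite H1 in Hs.
    change (INR 1) with 1 in Hs; rewrite Cmult_1_l in Hs. now subst g.
  - intros z f' Hz Hd.
    assert (L := carath_pseries beta _ _ z f' HT eq_refl H1 Hz Hd).
    apply is_pseries_Cconv in L.
    apply (cayley_Re_pos (z ^ m)%C).
    + rewrite Cmod_pow; apply pow_lt_1_compat; [split; [apply Cmod_ge_0|exact Hz]|exact Hm].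
    + apply ext_carath_series; auto.
      (* Here [carath_coef] applied to [ext_coef] gives back [ext_carath], the nonzero factor
         cancelling. *)
      eapply Cconv_shift with (p := 0%nat); [|exact L].
      intros n; rewrite Nat.add_0_r; induction n as [|n IH]; cbn [psum]; [reflexivity|].
      rewrite IH; f_equal; f_equal. unfold carath_coef, ext_coef.
      rewrite <- RtoC_mult; f_equal.
      assert (H := carath_factor_ge_1 beta n Hb). field; lra.
Qed.

(** The coefficients of index 2 to [m] vanish, so every product in [gamma] drops out and only half
    of the coefficient of index [m + 1] remains. *)
Lemma ext_gamma (beta : R) (m : nat) : 0 <= beta <= 1 -> (1 <= m <= 3)%nat ->
  Cmod (gamma (ext_coef beta m) m) = 1 / (INR (m + 1) - INR m * beta).
Proof.
  intros Hb Hm.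
  assert (Hd := carath_factor_ge_1 beta m Hb).
  rewrite Nat.add_1_r.
  set (d := INR (S m) - INR m * beta) in *.
  assert (Hlow : forall k, (0 < k < m)%nat -> ext_coef beta m (S k) = 0%C).
  { intros k Hk; unfold ext_coef, ext_carath.
    rewrite Nat.mod_small by lia; destruct (Nat.eq_dec k 0); [lia|].
    f_equal; unfold Rdiv; ring. }
  assert (Htop : ext_coef beta m (S m) = RtoC (2 * (1 / d))).
  { unfold ext_coef, ext_carath; fold d.
    rewrite Nat.Div0.mod_same; destruct (Nat.eq_dec m 0); [lia|].
    destruct (Nat.eq_dec 0 0); [|lia].
    f_equal; field; lra. }
  assert (Hg : gamma (ext_coef beta m) m = RtoC (1 / d)).
  { assert (N2 : RtoC 2 <> 0%C) by (apply RtoC_pos_neq_0; lra).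
    assert (N3 : RtoC 3 <> 0%C) by (apply RtoC_pos_neq_0; lra).
    rewrite RtoC_mult in Htop.
    destruct m as [|[|[|[|m]]]]; try lia; unfold gamma.
    - rewrite Htop; field; auto.
    - rewrite Htop, (Hlow 1%nat) by lia; cbn [Cpow]; field; auto.
    - rewrite Htop, (Hlow 1%nat), (Hlow 2%nat) by lia; cbn [Cpow]; field; auto. }
  rewrite Hg, Cmod_R; apply Rabs_pos_eq, Rdiv_le_0_compat; lra.
Qed.

Theorem theorem2p1 (beta : R) (Hb0 : 0 <= beta) (Hb1 : beta <= 1) :
  (forall (f : C -> C) (a : nat -> C),
     class_A_beta beta f -> taylor_coeffs f a ->
     forall m : nat, (1 <= m <= 3)%nat ->
       Cmod (gamma a m) <= 1 / (INR (m + 1) - INR m * beta))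
  /\
  (forall m : nat, (1 <= m <= 3)%nat ->
     exists (f : C -> C) (a : nat -> C),
       class_A_beta beta f /\ taylor_coeffs f a /\
       Cmod (gamma a m) = 1 / (INR (m + 1) - INR m * beta)).
Proof.
  split.
  - intros f a HA Hf m Hm; apply gamma_bound with f; auto.
  - intros m Hm; exists (ext_fun beta m), (ext_coef beta m); split; [|split].
    + apply ext_fun_class; [auto|lia].
    + apply ext_fun_taylor; auto.
    + apply ext_gamma; auto.
Qed.
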